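(* Let $d,n,k \ge 1$, let $U \subset \mathbb{R}^d$ be open, $x \in U$, $\phi \in C^k(U, \mathbb{R}^n)$, $y := \phi(x) \in \mathbb{R}^n$, and $f \in C^k(\mathbb{R}^n, \mathbb{R})$. Then for every multi-index $\alpha \in \mathbb{N}_0^d$ with $\alpha \neq 0$ and $|\alpha| \le k$, $$\frac{\partial^\alpha (f \circ \phi) (x)}{\alpha!} = \sum_{\beta\in\mathbb{N}_0^n} \partial^\beta f(y)\, \sum_{\rho\,(\ast)} \Bigl( \prod_{\gamma \in \mathbb{N}_0^d \setminus\{0\}} \frac{1}{\rho(\gamma)!} \frac{(\partial^\gamma \phi(x))^{\rho(\gamma)}}{(\gamma!)^{|\rho(\gamma)|}} \Bigr),$$ where $(\ast)$ runs over all finitely supported maps $\rho:\mathbb{N}_0^d\setminus\{0\} \to \mathbb{N}_0^n$ satisfying $\sum_\gamma \rho(\gamma) = \beta$ and $\sum_\gamma |\rho(\gamma)|\,\gamma = \alpha$.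
   Context: $\mathbb{N}_0 = \{0,1,2,\dots\}$. For a multi-index $\nu = (\nu_1,\dots,\nu_m) \in \mathbb{N}_0^m$: $|\nu| = \sum_i \nu_i$, $\nu! = \nu_1!\cdots\nu_m!$, and for $v = (v_1,\dots,v_m)\in\mathbb{R}^m$, $v^\nu = \prod_i v_i^{\nu_i}$. In particular, $\partial^\gamma\phi(x) \in \mathbb{R}^n$ and $\rho(\gamma)\in\mathbb{N}_0^n$, so $(\partial^\gamma \phi(x))^{\rho(\gamma)} = \prod_{i=1}^n (\partial^\gamma\phi_i(x))^{\rho(\gamma)_i}$, where $\phi_i$ is the $i$-th component of $\phi$. $C^k$ means $k$ times continuously differentiable, and $\partial^\nu\phi(x)$, $1 \le |\nu| \le k$, is the usual mixed partial derivative of order $\nu$, equivalently the coefficient of $v^\nu/\nu!$ in the Taylor polynomial $\sum_{\ell=1}^k \frac{1}{\ell!} D^\ell\phi(x)[v,\dots,v]$. Factors of the product with $\rho(\gamma)=0$ equal $1$. The inner sum over $\rho$ is empty (so the corresponding $\beta$ contributes $0$) unless $1 \le |\beta| \le |\alpha|$. *)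

(* Defs.v *)
From mathcomp Require Import all_boot all_order all_algebra finmap.
From mathcomp Require Import all_classical all_reals all_analysis.

Set Implicit Arguments.
Unset Strict Implicit.
Unset Printing Implicit Defensive.

Import Order.TTheory GRing.Theory Num.Theory.
Import numFieldNormedType.Exports.

Local Open Scope classical_set_scope.
Local Open Scope ring_scope.

(* Multi-indices are added pointwise, through the nmodType structure on
   finite functions; in particular [nu *+ m] is the multi-index m nu. *)
Notation multiindex m := {ffun 'I_m -> nat}.

Definition mdeg m (nu : multiindex m) : nat := (\sum_(i < m) nu i)%N.

Definition mfact m (nu : multiindex m) : nat := (\prod_(i < m) (nu i)`!)%N.

Definition mpow (R : realType) m (v : 'rV[R]_m) (nu : multiindex m) : R :=
  \prod_(i < m) v 0 i ^+ nu i.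

Notation nzmultiindex m := {nu : multiindex m | nu != 0}.

Section Derivatives.
Context (R : realType) (d : nat) (W : normedModType R).
Implicit Types (U : set 'rV[R]_d) (g : 'rV[R]_d -> W).

(* For g of class C^k on an open set U; only the values of g on U matter.
   The derivative x |-> 'd g x, with values in the linear maps from R^d to W,
   is required to be C^k through its evaluations x |-> 'd g x v: as R^d is
   finite dimensional, these determine the topology of that space. *)
Fixpoint Ck (k : nat) U g : Prop :=
  if k is k'.+1 then
    (forall x, U x -> differentiable g x) /\
    (forall v : 'rV[R]_d, Ck k' U (fun x => 'd g x v))
  else forall x, U x -> {for x, continuous g}.

Definition partial (i : 'I_d) g : 'rV[R]_d -> W :=
  fun x => 'D_(delta_mx 0 i) g x.

(* The partial derivatives are taken in a fixed order: nu_i times in the i-th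
   variable, the last variable first. *)
Definition mpartial (nu : multiindex d) g : 'rV[R]_d -> W :=
  foldr (fun i h => iter (nu i) (partial i) h) g (enum 'I_d).

End Derivatives.

Definition faa_di_bruno_index d n (alpha : multiindex d) (beta : multiindex n) :
    set {fsfun nzmultiindex d -> multiindex n with 0} :=
  [set rho | \sum_(gamma \in [set: nzmultiindex d]) rho gamma = beta /\
     \sum_(gamma \in [set: nzmultiindex d])
        (val gamma *+ mdeg (rho gamma)) = alpha].

(* Main.v *)
Require Import Defs.
From mathcomp Require Import all_boot all_order all_algebra finmap.
From mathcomp Require Import all_classical all_reals all_analysis.
From mathcomp Require Import ring zify.
Import Order.TTheory GRing.Theory Num.Theory.
Import numFieldNormedType.Exports.
Local Open Scope classical_set_scope.
Local Open Scope ring_scope.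

Set Implicit Arguments.
Unset Strict Implicit.
Unset Printing Implicit Defensive.

(** Both sides are computed as functions of the base point x, by induction on
    |alpha|.

    Write a_(gamma, j)(x) for the Taylor coefficient of phi_j of order gamma at x,
    and V(alpha, beta)(x) for the inner sum over rho, which is the coefficient of
    X^alpha in the product over j of P_j^(beta_j) / (beta_j)!, where P_j is the
    Taylor polynomial of phi_j without its constant term. With

      S_alpha(x) = sum over beta of (d^beta f)(phi x) V(alpha, beta)(x),

    the claim is that S_alpha is the Taylor coefficient of f o phi of order alpha.
    Since d_i turns the Taylor coefficient of order alpha into alpha_i + 1 times the
    one of order alpha + e_i, it is enough that d_i S_alpha equals
    (alpha_i + 1) S_(alpha + e_i) ([faa_di_bruno_box]).

    The chain rule gives the derivative of (d^beta f)(phi x). The derivative of V is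
    ([is_derive_partition_sum])

      d_i V(alpha, beta) = (alpha_i + 1) V(alpha + e_i, beta)
                           - sum over l of (d_i phi_l) V(alpha, beta - e_l),

    because the derivative of P_j in the point x is its derivative in the formal
    variable X_i, except for the constant term d_i phi_j of the latter. The
    negative terms are cancelled by the chain rule, after a shift of beta
    ([sum_box_cancel]).

    Instead of polynomials, the proof of the formula for d_i V uses the recursion
    ([partition_sum_rec])

      beta_j V(alpha, beta) = sum over gamma of
                              a_(gamma, j) V(alpha - gamma, beta - e_j),

    obtained by double counting: beta_j is the sum over gamma of rho(gamma)_j, and
    decreasing rho(gamma)_j by one is a bijection onto the maps rho for the
    smaller targets. It determines V and reduces the formula for beta to the one
    for beta - e_j ([partition_sum_rec_shift]).

    The partial derivatives are taken in a prescribed order of the variables.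
    That d_i applied to the derivative of order gamma is the one of order
    gamma + e_i rests on the symmetry of second derivatives ([schwarz]), which is
    deduced from the mean value theorem. *)

(** * Multi-indices *)

Definition mdelta m (i : 'I_m) : multiindex m := [ffun j => (j == i : nat)].

Definition lower m (i : 'I_m) (nu : multiindex m) : multiindex m :=
  [ffun j => (nu j - (j == i))%N].

Definition mint m (nu : multiindex m) : {ffun 'I_m -> int} := [ffun i => (nu i)%:Z].

Definition isum m (A : {ffun 'I_m -> int}) : int := \sum_(i < m) A i.

Section Multiindices.
Context (m : nat).
Implicit Types (mu nu : multiindex m) (A : {ffun 'I_m -> int}).

Lemma add_mdeltaE nu i j : (nu + mdelta i) j = (nu j + (j == i))%N.
Proof. by rewrite !ffunE. Qed.

Lemma add_mdelta_inj i : injective (fun nu => nu + mdelta i).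
Proof.
by move=> mu nu /ffunP E; apply/ffunP => k; have := E k; rewrite !add_mdeltaE => /addIn.
Qed.

Lemma lowerK i nu : nu i != 0%N -> lower i nu + mdelta i = nu.
Proof.
move=> nui; apply/ffunP => j; rewrite add_mdeltaE ffunE.
by case: eqVneq => [->|_]; [rewrite subnK// lt0n|rewrite subn0 addn0].
Qed.

Lemma mdegD mu nu : mdeg (mu + nu) = (mdeg mu + mdeg nu)%N.
Proof. by rewrite /mdeg -big_split; apply: eq_bigr => i _; rewrite ffunE. Qed.

Lemma mdeg0 : mdeg (0 : multiindex m) = 0%N.
Proof. by rewrite /mdeg big1// => i _; rewrite ffunE. Qed.

Lemma mdeg_mdelta (i : 'I_m) : mdeg (mdelta i) = 1%N.
Proof.
rewrite /mdeg (bigD1 i)//= ffunE eqxx big1 ?addn0// => k /negbTE ki.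
by rewrite ffunE ki.
Qed.

Lemma mdeg_eq0 nu : (mdeg nu == 0%N) = (nu == 0).
Proof.
apply/eqP/eqP => [|->]; last exact: mdeg0.
move=> /eqP; rewrite /mdeg sum_nat_eq0 => /forallP nu0; apply/ffunP => i.
by rewrite [RHS]ffunE; apply/eqP; have := nu0 i.
Qed.

Lemma leq_mdeg nu i : (nu i <= mdeg nu)%N.
Proof. by rewrite /mdeg (bigD1 i)//= leq_addr. Qed.

Lemma multiindex_neq0P nu : nu != 0 -> exists i, nu i != 0%N.
Proof.
move=> nu0; apply/existsP; apply: contraNT nu0 => /existsPn nu0.
by apply/eqP/ffunP => i; rewrite [RHS]ffunE; apply/eqP; move/negPn: (nu0 i).
Qed.

Lemma mfact0 : mfact (0 : multiindex m) = 1%N.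
Proof. by rewrite /mfact big1// => i _; rewrite ffunE. Qed.

Lemma mfact_mdelta nu i : mfact (nu + mdelta i) = ((nu i).+1 * mfact nu)%N.
Proof.
rewrite /mfact (bigD1 i)//= [in RHS](bigD1 i)//= add_mdeltaE eqxx addn1 factS.
rewrite mulnA; congr (_ * _)%N; apply: eq_bigr => k /negbTE ki.
by rewrite add_mdeltaE ki addn0.
Qed.

Lemma mfact_neq0 (R : numDomainType) nu : (mfact nu)%:R != 0 :> R.
Proof. by rewrite pnatr_eq0 -lt0n /mfact prodn_gt0// => i; exact: fact_gt0. Qed.

Lemma mintD mu nu : mint (mu + nu) = mint mu + mint nu.
Proof. by apply/ffunP => i; rewrite !ffunE. Qed.

Lemma mint0 : mint (0 : multiindex m) = 0.
Proof. by apply/ffunP => i; rewrite !ffunE. Qed.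

Lemma mint_inj : injective (@mint m).
Proof. by move=> mu nu /ffunP E; apply/ffunP => i; have := E i; rewrite !ffunE => -[]. Qed.

Lemma isumB A A' : isum (A - A') = isum A - isum A'.
Proof. by rewrite /isum -sumrB; apply: eq_bigr => i _; rewrite !ffunE. Qed.

Lemma isum_mint nu : isum (mint nu) = (mdeg nu)%:Z.
Proof.
rewrite /isum /mdeg (big_morph Posz PoszD (erefl 0)).
by apply: eq_bigr => i _; rewrite ffunE.
Qed.

Lemma mint_or_negative A : (exists nu, A = mint nu) \/ exists i, A i < 0.
Proof.
have [/forallP A0|/forallPn[i]] := boolP [forall i, 0 <= A i]; last first.
  by rewrite -ltNge; right; exists i.
left; exists [ffun i => `|A i|%N]; apply/ffunP => i; rewrite !ffunE.
by rewrite gez0_abs.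
Qed.

(** Sums over multi-indices have finite support but must be differentiated term
    by term, so they are written as sums over the finite list of multi-indices
    with entries below a bound. *)
Definition box N : seq (multiindex m) :=
  [seq [ffun i => val (g i)] | g : {ffun 'I_m -> 'I_N} <- enum {: {ffun 'I_m -> 'I_N}}].

Lemma mem_box N nu : (nu \in box N) = [forall i, (nu i < N)%N].
Proof.
apply/mapP/forallP => [[g _ ->] i|nuN]; first by rewrite ffunE ltn_ord.
exists [ffun i => Ordinal (nuN i)]; first by rewrite mem_enum.
by apply/ffunP => i; rewrite !ffunE.
Qed.

Lemma box_uniq N : uniq (box N).
Proof.
rewrite /box map_inj_uniq ?enum_uniq// => g g' /ffunP E; apply/ffunP => i.
by have := E i; rewrite !ffunE; exact: val_inj.
Qed.

(** Reindexing along nu |-> nu + e_i: the image of this injection is the set of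
    multi-indices whose i-th entry is positive, and the box is large enough for
    its boundary to contribute nothing. *)
Lemma big_box_shift (T : nmodType) N (F : multiindex m -> T) i :
  (forall nu, nu \notin box N -> F nu = 0) -> (forall nu, nu i = 0%N -> F nu = 0) ->
  \sum_(nu <- box N) F nu = \sum_(nu <- box N) F (nu + mdelta i).
Proof.
move=> Fbox F0.
have big_box (G : multiindex m -> T) : (forall nu, nu \notin box N -> G nu = 0) ->
    \sum_(nu <- box N) G nu = \sum_(nu \in [set: multiindex m]) G nu.
  move=> Gbox; rewrite (fsbigE (box N)) ?box_uniq//; last by move=> nu _ /Gbox.
  by apply: eq_bigl => nu; rewrite in_setT.
rewrite [RHS]big_box; last first.
  move=> nu nuN; apply: Fbox; apply: contra nuN; rewrite !mem_box.
  move=> /forallP nuN; apply/forallP => k; apply: leq_ltn_trans (nuN k).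
  by rewrite add_mdeltaE leq_addr.
rewrite big_box//; pose shifted := [set nu : multiindex m | nu i != 0%N].
rewrite -(@fsbig_widen _ T 0 +%R shifted) => //; last first.
  by move=> nu [_ /negP]; rewrite negbK => /eqP/F0.
apply: reindex_fsbig; split => [nu _|nu mu _ _|nu /= nui].
- by rewrite /shifted /= add_mdeltaE eqxx addn1.
- exact: add_mdelta_inj.
by exists (lower i nu) => //; exact: lowerK.
Qed.

Lemma big_box_neq0 (T : nmodType) N (F : multiindex m -> T) : (0 < N)%N ->
  \sum_(nu <- box N) F nu = F 0 + \sum_(nu <- box N | nu != 0) F nu.
Proof.
move=> N0; rewrite (bigD1_seq 0)//= ?box_uniq// mem_box.
by apply/forallP => i; rewrite ffunE.
Qed.

End Multiindices.

(** * Functions of class C^k *)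

Section Regularity.
Context (R : realType) (d : nat).

Lemma near_eq_differentiable (V W : normedModType R) (g h : V -> W) (x : V) :
  {near x, g =1 h} -> differentiable g x -> differentiable h x.
Proof.
move=> gh dg.
have gh0 : \forall y \near (0 : V), g (y + x) = h (y + x).
  by move/nbhs0P: gh; apply: filterS => y; rewrite addrC.
have expansion : h \o shift x = cst (h x) + 'd g x +o_ 0 id.
  apply/eqaddoP => e e0.
  have /eqaddoP/(_ e e0) := diff_locally dg.
  rewrite -(nbhs_singleton gh).
  apply: filter_app; move: gh0; apply: filterS => y ghy.
  by rewrite !fctE /= ghy.
have dhE := diff_unique (diff_continuous dg) expansion.
apply/diff_locallyP; split; first by rewrite dhE; exact: diff_continuous.
by rewrite dhE.
Qed.

Lemma Ck_congr (W : normedModType R) (U : set 'rV[R]_d) (oU : open U) k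
    (g h : 'rV[R]_d -> W) :
  (forall x, U x -> g x = h x) -> Ck k U g -> Ck k U h.
Proof.
elim: k g h => [|k IH] g h gh /=;
  have ghN x : U x -> {near x, g =1 h}
    by move=> Ux; near do apply: gh; exact: open_nbhs_nbhs.
  move=> cg x Ux.
  have hgx : h @ x --> g x.
    apply: cvg_trans (cg x Ux).
    exact: (@near_eq_cvg _ _ (nbhs x) _ g h (ghN x Ux)).
  by rewrite gh in hgx.
move=> [dg Cg]; have dh x (Ux : U x) := near_eq_differentiable (ghN x Ux) (dg x Ux).
split; first exact: dh.
move=> v; apply: IH (Cg v) => x Ux.
by rewrite -!deriveE//; [exact: near_eq_derive (ghN x Ux)|exact: dh|exact: dg].
Unshelve. all: by end_near. Qed.

Lemma Ck_le (W : normedModType R) (U : set 'rV[R]_d) k l (g : 'rV[R]_d -> W) :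
  (l <= k)%N -> Ck k U g -> Ck l U g.
Proof.
elim: k l g => [|k IH] [|l] g //= lk [dg Cg].
  by move=> x Ux; exact: differentiable_continuous (dg x Ux).
by split=> // v; exact: IH (Cg v).
Qed.

Lemma Ck_differentiable (W : normedModType R) (U : set 'rV[R]_d) k
    (g : 'rV[R]_d -> W) (x : 'rV[R]_d) :
  (0 < k)%N -> Ck k U g -> U x -> differentiable g x.
Proof. by case: k => // k _ [dg _]; exact: dg. Qed.

Lemma Ck_derive (W : normedModType R) (U : set 'rV[R]_d) (oU : open U) k v
    (g : 'rV[R]_d -> W) :
  Ck k.+1 U g -> Ck k U ('D_v g).
Proof.
move=> [dg Cg]; apply: (Ck_congr oU _ (Cg v)) => x Ux.
by rewrite deriveE; [|exact: dg].
Qed.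

Lemma Ck_coord n (U : set 'rV[R]_d) (oU : open U) k
    (phi : 'rV[R]_d -> 'rV[R]_n) j :
  Ck k U phi -> Ck k U (fun x => phi x 0 j).
Proof.
elim: k phi => [|k IH] phi /=.
  move=> cphi x Ux.
  apply: (@continuous_comp _ _ _ phi (fun y : 'rV[R]_n => y 0 j) x (cphi x Ux)).
  exact: coord_continuous.
move=> [dphi Cphi]; split.
  move=> x Ux.
  apply: (@differentiable_comp _ _ _ _ phi (fun y : 'rV[R]_n => y 0 j)).
    exact: dphi.
  exact: differentiable_coord.
move=> v; apply: Ck_congr (IH _ (Cphi v)) => // x Ux.
have dphix := dphi x Ux.
have dcoord : differentiable (fun y : 'rV[R]_n => y 0 j) (phi x).
  exact: differentiable_coord.
rewrite -!deriveE//; last exact: (differentiable_comp dphix dcoord).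
by rewrite derive_mx ?mxE//; exact: diff_derivable.
Qed.

End Regularity.

(** * Symmetry of second derivatives *)

Section Schwarz.
Context (R : realType) (d : nat).
Implicit Types (g : 'rV[R]_d -> R) (U : set 'rV[R]_d).

Lemma is_derive_line g (p u : 'rV[R]_d) (s : R) :
  differentiable g (p + s *: u) ->
  is_derive s 1 (fun t => g (p + t *: u)) ('D_u g (p + s *: u)).
Proof.
move=> dg; have dgu : is_derive (p + s *: u) u g ('D_u g (p + s *: u)).
  exact/derivableP/diff_derivable.
have E : (fun h : R => h^-1 *: (g (p + (h *: 1 + s) *: u) - g (p + s *: u))) =
  (fun h : R => h^-1 *: (g (h *: u + (p + s *: u)) - g (p + s *: u))).
  apply/funext => h; congr (_ *: (g _ - _)).
  by rewrite scalerDl [h *: 1]mulr1 addrCA.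
have [dd dE] := dgu.
by apply: DeriveDef; rewrite /derivable /derive E.
Qed.

(** The second difference of g over the parallelogram spanned by h u and h v is
    an increment of s |-> g(x + s u + h v) - g(x + s u); the mean value theorem
    turns it into h times an increment of 'D_u g in the direction v, to which
    the theorem applies again. *)
Lemma second_difference_mvt g (x u v : 'rV[R]_d) (h : R) : 0 < h ->
  (forall s t, 0 <= s <= h -> 0 <= t <= h ->
     differentiable g (x + s *: u + t *: v) /\
     differentiable ('D_u g) (x + s *: u + t *: v)) ->
  exists s t, [/\ 0 <= s <= h, 0 <= t <= h &
    g (x + h *: u + h *: v) - g (x + h *: u) - (g (x + h *: v) - g x) =
    'D_v ('D_u g) (x + s *: u + t *: v) * h * h].
Proof.
move=> h0 dg.
have in0h s : s \in `]0, h[ -> 0 <= s <= h.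
  by rewrite in_itv/= => /andP[/ltW -> /ltW ->].
have h0h : 0 <= h <= h by rewrite ltW/=.
have l0h : 0 <= (0 : R) <= h by rewrite lexx ltW.
pose F s := g (x + h *: v + s *: u) - g (x + s *: u).
have dF s : 0 <= s <= h ->
  is_derive s 1 F ('D_u g (x + h *: v + s *: u) - 'D_u g (x + s *: u)).
  move=> sh; apply: is_deriveB; apply: is_derive_line.
    by rewrite addrAC; exact: (dg s h sh h0h).1.
  by have := (dg s 0 sh l0h).1; rewrite scale0r addr0.
have [s /in0h sh FE] : exists2 c, c \in `]0, h[ & F h - F 0 =
    ('D_u g (x + h *: v + c *: u) - 'D_u g (x + c *: u)) * (h - 0).
  apply: (MVT h0); first by move=> s /in0h; exact: dF.
  apply: derivable_within_continuous => s; rewrite in_itv/= => sh.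
  by have [] := dF s sh.
pose G t := 'D_u g (x + s *: u + t *: v).
have dG t : 0 <= t <= h -> is_derive t 1 G ('D_v ('D_u g) (x + s *: u + t *: v)).
  by move=> th; apply: is_derive_line; exact: (dg s t sh th).2.
have [t /in0h th GE] : exists2 c, c \in `]0, h[ & G h - G 0 =
    'D_v ('D_u g) (x + s *: u + c *: v) * (h - 0).
  apply: (MVT h0); first by move=> t /in0h; exact: dG.
  apply: derivable_within_continuous => t; rewrite in_itv/= => th.
  by have [] := dG t th.
exists s, t; split=> //; move: FE GE; rewrite /F /G !scale0r !addr0 subr0 => FE GE.
by rewrite -GE [x + s *: u + h *: v]addrAC -FE [x + h *: v + _]addrAC.
Qed.

(** The second difference is symmetric in u and v, so both orders of derivation
    take a common value, each at its own point of an arbitrarily small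
    parallelogram; continuity at x identifies the limits. *)
Lemma schwarz g U (oU : open U) (x : 'rV[R]_d) (u v : 'rV[R]_d) :
  U x -> Ck 2 U g -> 'D_v ('D_u g) x = 'D_u ('D_v g) x.
Proof.
move=> Ux Cg.
have dg y : U y -> differentiable g y by exact: Ck_differentiable Cg.
have dDg w y : U y -> differentiable ('D_w g) y.
  by apply: Ck_differentiable (Ck_derive oU w Cg).
have cDDg w w' : {for x, continuous ('D_w' ('D_w g))}.
  exact: (Ck_derive oU w' (Ck_derive oU w Cg)).
have close (e A B C C' : R) : C = C' ->
    `|A - C| < e / 2 -> `|B - C'| < e / 2 -> `|A - B| < e.
  move=> -> AC BC; rewrite [e]splitr -[A - B](subrKA C').
  by rewrite (le_lt_trans (ler_normD _ _))// ltrD// -normrN opprB.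
have cancel (h A B a b c c' : R) : 0 < h -> a - b - (c - c') = A * h * h ->
    a - c - (b - c') = B * h * h -> A = B.
  move=> h0 EA EB; apply/(mulIf (lt0r_neq0 h0))/(mulIf (lt0r_neq0 h0)).
  by rewrite -EA -EB; ring.
apply/eqP; rewrite -subr_eq0 -normr_le0 leNgt; apply/negP.
set e := `| _ | => e0.
have e2 : 0 < e / 2 by rewrite divr_gt0.
have nearU : \forall y \near x, U y by exact: open_nbhs_nbhs.
have near_uv w w' : \forall y \near x,
    `|'D_w' ('D_w g) x - 'D_w' ('D_w g) y| < e / 2.
  by move: (cDDg w w') => /cvgrPdist_lt/(_ _ e2).
have near3 : \forall y \near x, [/\ U y,
    `|'D_v ('D_u g) x - 'D_v ('D_u g) y| < e / 2 &
    `|'D_u ('D_v g) x - 'D_u ('D_v g) y| < e / 2].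
  by apply: filterS3 nearU (near_uv u v) (near_uv v u) => y Uy b1 b2; split.
have [r /= r0 rP] := (nbhs_normP _ _).1 near3.
(* A parallelogram with sides h u and h v lies in the ball of radius r. *)
pose h := r / (`|u| + `|v| + 1).
have D0 : 0 < `|u| + `|v| + 1 by rewrite ltr_wpDl// addr_ge0.
have h0 : 0 < h by rewrite divr_gt0.
have inball s t : 0 <= s <= h -> 0 <= t <= h ->
    ball_ Num.norm x r (x + s *: u + t *: v).
  move=> /andP[s0 sh] /andP[t0 th]; rewrite /ball_ /= -addrA opprD addNKr.
  rewrite normrN (le_lt_trans (ler_normD _ _))// !normrZ !ger0_norm//.
  apply: (@le_lt_trans _ _ (h * (`|u| + `|v|))).
    by rewrite mulrDr lerD// ler_wpM2r.
  have -> : r = h * (`|u| + `|v| + 1) by rewrite /h divfK// gt_eqF.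
  by rewrite ltr_pM2l// ltrDl.
have [s [t [sh th E1]]] : exists s t, [/\ 0 <= s <= h, 0 <= t <= h &
    g (x + h *: u + h *: v) - g (x + h *: u) - (g (x + h *: v) - g x) =
    'D_v ('D_u g) (x + s *: u + t *: v) * h * h].
  apply: second_difference_mvt h0 _ => s t sh th.
  by have [Uy _ _] := rP _ (inball s t sh th); split; [exact: dg|exact: dDg].
have [t' [s' [th' sh' E2]]] : exists s t, [/\ 0 <= s <= h, 0 <= t <= h &
    g (x + h *: v + h *: u) - g (x + h *: v) - (g (x + h *: u) - g x) =
    'D_u ('D_v g) (x + s *: v + t *: u) * h * h].
  apply: second_difference_mvt h0 _ => t' s' th' sh'; rewrite addrAC.
  by have [Uy _ _] := rP _ (inball s' t' sh' th'); split; [exact: dg|exact: dDg].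
have E : 'D_v ('D_u g) (x + s *: u + t *: v) =
         'D_u ('D_v g) (x + s' *: u + t' *: v).
  apply: (cancel _ _ _ _ _ _ _ h0 E1); rewrite [x + h *: u + h *: v]addrAC.
  by rewrite [x + s' *: u + _]addrAC.
have [_ b1 _] := rP _ (inball s t sh th).
have [_ _ b2] := rP _ (inball s' t' sh' th').
by have := close _ _ _ _ _ E b1 b2; rewrite ltxx.
Qed.

End Schwarz.

(** * Iterated partial derivatives *)

Arguments Ck : simpl never.

Section IteratedPartials.
Context (R : realType) (d : nat) (W : normedModType R).
Context (U : set 'rV[R]_d) (oU : open U).
Implicit Types (g h : 'rV[R]_d -> W) (nu : multiindex d) (s : seq 'I_d).

Lemma eq_partial i g h : (forall x, U x -> g x = h x) ->
  forall x, U x -> partial i g x = partial i h x.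
Proof.
move=> gh x Ux; apply: near_eq_derive.
have nU : \forall y \near x, U y by exact: open_nbhs_nbhs.
by apply: filterS nU => y; exact: gh.
Qed.

Lemma eq_iter_partial n i g h : (forall x, U x -> g x = h x) ->
  forall x, U x -> iter n (partial i) g x = iter n (partial i) h x.
Proof. by move=> gh; elim: n => [|n IH] //=; exact: eq_partial. Qed.

Lemma Ck_partial k i g : Ck k.+1 U g -> Ck k U (partial i g).
Proof. exact: Ck_derive. Qed.

Lemma Ck_iter_partial k n i g : Ck (n + k) U g -> Ck k U (iter n (partial i) g).
Proof.
by elim: n k => [|n IH] k //= Cg; apply: Ck_partial; apply: IH; rewrite addnS.
Qed.

(** [mpartial] is the case of the full enumeration of the variables; inductions
    need the derivatives in the variables of an arbitrary list. *)
Definition nested s nu g := foldr (fun i h => iter (nu i) (partial i) h) g s.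

Lemma Ck_nested k s nu g :
  Ck ((\sum_(j <- s) nu j) + k)%N U g -> Ck k U (nested s nu g).
Proof.
elim: s k => [|j s IH] k; first by rewrite big_nil.
rewrite big_cons => Cg /=; apply: Ck_iter_partial; apply: IH.
by rewrite addnA [(_ + nu j)%N]addnC.
Qed.

Lemma Ck_mpartial k nu g : Ck (mdeg nu + k)%N U g -> Ck k U (mpartial nu g).
Proof. by move=> Cg; apply: Ck_nested; rewrite big_enum. Qed.

End IteratedPartials.

Section MixedPartials.
Context (R : realType) (d : nat).
Context (U : set 'rV[R]_d) (oU : open U).
Implicit Types (g h : 'rV[R]_d -> R) (nu : multiindex d) (s : seq 'I_d).

Lemma partial_comm i j g x : Ck 2 U g -> U x ->
  partial i (partial j g) x = partial j (partial i g) x.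
Proof. by move=> Cg Ux; exact: schwarz Cg. Qed.

Lemma partial_iter_comm n i j g : Ck n.+1 U g ->
  forall x, U x -> partial i (iter n (partial j) g) x =
                   iter n (partial j) (partial i g) x.
Proof.
elim: n => [|n IH] //= Cg x Ux.
rewrite partial_comm//; last by apply: Ck_iter_partial => //; rewrite addn2.
apply: (eq_partial oU) => // y Uy; apply: IH => //; exact: Ck_le Cg.
Qed.

Lemma nested_notin s nu i g :
  i \notin s -> nested s (nu + mdelta i) g = nested s nu g.
Proof.
elim: s => [|j s IH] //=; rewrite inE negb_or => /andP[ij /IH ->].
by rewrite add_mdeltaE eq_sym (negbTE ij) addn0.
Qed.

(** The new derivative is moved inwards, past those in the variables that precede
    i in the list, until it meets those in the i-th variable. *)
Lemma partial_nested s nu i g : uniq s -> i \in s ->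
  Ck (\sum_(j <- s) nu j).+1 U g ->
  forall x, U x -> partial i (nested s nu g) x = nested s (nu + mdelta i) g x.
Proof.
elim: s => [|j s IH] //= /andP[js us]; rewrite inE big_cons => + Cg x Ux.
have [ij _|ij /= si] := eqVneq i j.
  by subst j; rewrite nested_notin// add_mdeltaE eqxx addn1.
rewrite add_mdeltaE eq_sym (negbTE ij) addn0 partial_iter_comm//.
  apply: (eq_iter_partial oU) => // y Uy; apply: IH => //.
  by apply: Ck_le Cg; rewrite ltnS leq_addl.
by apply: Ck_nested => //; rewrite addnS addnC.
Qed.

Lemma partial_mpartial nu i g x : Ck (mdeg nu).+1 U g -> U x ->
  partial i (mpartial nu g) x = mpartial (nu + mdelta i) g x.
Proof.
move=> Cg Ux; apply: partial_nested => //; first exact: enum_uniq.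
  by rewrite mem_enum.
by rewrite big_enum.
Qed.

End MixedPartials.

Lemma mpartial0 (R : realType) d (W : normedModType R) (g : 'rV[R]_d -> W) :
  mpartial 0 g = g.
Proof. by rewrite /mpartial; elim: (enum 'I_d) => [|i s IH] //=; rewrite ffunE. Qed.

(** The variable is the first one that alpha involves: its derivatives are the
    outermost ones. As no derivatives are exchanged, the identity applies to f o phi
    before anything is known about the regularity of this composite. *)
Lemma mpartial_outermost (R : realType) d (alpha : multiindex d) : alpha != 0 ->
  exists i alpha', alpha = alpha' + mdelta i /\
    forall g : 'rV[R]_d -> R, mpartial alpha g = partial i (mpartial alpha' g).
Proof.
move=> /multiindex_neq0P[i0 ai0].
have first_variable (s : seq 'I_d) : uniq s -> has (fun i => alpha i != 0%N) s ->
    exists2 i, alpha i != 0%N & forall g : 'rV[R]_d -> R,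
      nested s alpha g = partial i (nested s (lower i alpha) g).
  elim: s => [|j s IH] //= /andP[js us].
  have [aj /= /(IH us)[i ai aiE]|aj _] := eqVneq (alpha j) 0%N.
    by exists i => // g; rewrite aj aiE ffunE aj.
  exists j => // g; rewrite ffunE eqxx.
  have {1}-> : alpha j = (alpha j - 1).+1 by rewrite subn1 prednK// lt0n.
  congr (partial j (iter _ _ _)).
  by rewrite -[in LHS](lowerK aj) nested_notin.
have [||i ai alphaE] := first_variable (enum 'I_d); first exact: enum_uniq.
  by apply/hasP; exists i0; rewrite ?mem_enum.
by exists i, (lower i alpha); split; [rewrite lowerK|exact: alphaE].
Qed.

Section Coordinates.
Context (R : realType) (d n : nat) (U : set 'rV[R]_d) (oU : open U) (j : 'I_n).
Implicit Type phi : 'rV[R]_d -> 'rV[R]_n.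

Lemma iter_partial_coord m i phi (psi : 'rV[R]_d -> R) :
  Ck m U phi -> (forall x, U x -> phi x 0 j = psi x) ->
  forall x, U x -> iter m (partial i) phi x 0 j = iter m (partial i) psi x.
Proof.
move=> + phipsi; elim: m => [|m IH] Cphi x Ux; first exact: phipsi.
have C1 : Ck 1 U (iter m (partial i) phi).
  by apply: Ck_iter_partial => //; rewrite addn1.
have dphi : derivable (iter m (partial i) phi) x (delta_mx 0 i).
  by apply: diff_derivable; exact: Ck_differentiable C1 _.
rewrite !iterS [LHS](_ : _ = partial i (fun y => iter m (partial i) phi y 0 j) x).
  by apply: (eq_partial oU) => // y Uy; apply: IH => //; exact: Ck_le Cphi.
by rewrite {1}/partial derive_mx// mxE.
Qed.

Lemma mpartial_coord nu phi x : Ck (mdeg nu) U phi -> U x ->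
  mpartial nu phi x 0 j = mpartial nu (fun y => phi y 0 j) x.
Proof.
rewrite /mdeg -big_enum => Cphi; rewrite /mpartial.
elim: (enum 'I_d) Cphi x => [|i s IH] //=; rewrite big_cons => Cphi.
apply: iter_partial_coord; first by apply: Ck_nested => //; rewrite addnC.
by apply: IH; apply: Ck_le Cphi; exact: leq_addl.
Qed.

End Coordinates.

Lemma partial_comp (R : realType) d n (h : 'rV[R]_n -> R)
    (phi : 'rV[R]_d -> 'rV[R]_n) (x : 'rV[R]_d) (i : 'I_d) :
  differentiable phi x -> differentiable h (phi x) ->
  is_derive x (delta_mx 0 i) (h \o phi)
    (\sum_(j < n) partial j h (phi x) * partial i (fun y => phi y 0 j) x).
Proof.
move=> dphi dh; have dhphi := differentiable_comp dphi dh.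
apply: DeriveDef; first exact: diff_derivable.
rewrite (deriveE _ dhphi) diff_comp//= -(deriveE _ dphi) derive_mx;
  last exact: diff_derivable.
set v := \matrix_(_, _) _; rewrite [v]row_sum_delta linear_sum/=.
by apply: eq_bigr => j _; rewrite linearZ /= -(deriveE _ dh) mxE mulrC.
Qed.

(** * Assignments of multi-indices *)

Section Assignments.
Context (d n : nat).
Local Notation assignment := {fsfun nzmultiindex d -> multiindex n with 0}.
Implicit Types (rho : assignment) (gamma : nzmultiindex d) (j : 'I_n).

Definition total rho : multiindex n :=
  \sum_(gamma \in [set: nzmultiindex d]) rho gamma.
Definition weighted_total rho : multiindex d :=
  \sum_(gamma \in [set: nzmultiindex d]) (val gamma *+ mdeg (rho gamma)).

Definition bump gamma j rho : assignment :=
  [fsfun rho with gamma |-> rho gamma + mdelta j].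

Lemma bumpE gamma j rho gamma' :
  bump gamma j rho gamma' = rho gamma' + (if gamma' == gamma then mdelta j else 0).
Proof. by rewrite /bump fsfun_withE; case: eqVneq => [->|]; rewrite ?addr0. Qed.

Lemma unbump gamma j rho : rho gamma j != 0%N -> exists rho', rho = bump gamma j rho'.
Proof.
move=> rj; exists [fsfun rho with gamma |-> lower j (rho gamma)].
apply/fsfunP => gamma'; rewrite bumpE fsfun_withE.
by case: eqVneq => [->|_]; [rewrite lowerK|rewrite addr0].
Qed.

Lemma bump_inj gamma j : injective (bump gamma j).
Proof.
move=> rho rho' /(congr1 (fun r : assignment => fun g => r g)) E.
apply/fsfunP => g; have := congr1 (fun f => f g) E; rewrite /= !bumpE.
by case: eqP => _; [exact: add_mdelta_inj|rewrite !addr0].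
Qed.

(** Sums and products over all gamma share all but one of their factors at rho and
    at bump gamma j rho; the common part is t. *)
Lemma fsbig_bump (T : Type) (idx : T) (op : Monoid.com_law idx)
    (F : nzmultiindex d -> multiindex n -> T) gamma j rho :
  (forall g, F g 0 = idx) ->
  exists t, \big[op/idx]_(g \in [set: nzmultiindex d]) F g (rho g) =
              op (F gamma (rho gamma)) t /\
    \big[op/idx]_(g \in [set: nzmultiindex d]) F g (bump gamma j rho g) =
              op (F gamma (rho gamma + mdelta j)) t.
Proof.
move=> F0; pose S := (gamma |` finsupp rho)%fset.
have outS g : g \notin S -> rho g = 0 /\ g != gamma.
  by rewrite !inE negb_or => /andP[? /fsfun_dflt].
have gS : gamma \in S by rewrite !inE eqxx.
exists (\big[op/idx]_(g <- (S `\ gamma)%fset) F g (rho g)); split.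
  rewrite (fsbigTE S) => [|g /outS[-> _]//].
  by rewrite (big_fsetD1 gamma gS).
rewrite (fsbigTE S) => [|g /outS[rg /negbTE gg]]; last by rewrite bumpE rg gg addr0.
rewrite (big_fsetD1 gamma gS)/= bumpE eqxx; congr (op _ _).
by apply: eq_big_seq => g; rewrite !inE bumpE => /andP[/negbTE -> _]; rewrite addr0.
Qed.

Lemma total_bump gamma j rho : total (bump gamma j rho) = total rho + mdelta j.
Proof.
rewrite /total; have [t [-> ->]] :=
  @fsbig_bump (multiindex n) 0 +%R (fun _ mu => mu) gamma j rho (fun=> erefl).
by rewrite /= addrAC.
Qed.

Lemma weighted_total_bump gamma j rho :
  weighted_total (bump gamma j rho) = weighted_total rho + val gamma.
Proof.
rewrite /weighted_total; have [t [-> ->]] :=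
  @fsbig_bump (multiindex d) 0 +%R (fun g mu => val g *+ mdeg mu) gamma j rho
    (fun g => congr1 (fun k => val g *+ k) (@mdeg0 n)).
by rewrite /= mdegD mdeg_mdelta mulrnDr mulr1n addrAC.
Qed.

Lemma total0 : total [fsfun with 0] = 0.
Proof. by rewrite /total fsbig1// => g _; rewrite fsfun0E. Qed.

Lemma weighted_total0 : weighted_total [fsfun with 0] = 0.
Proof. by rewrite /weighted_total fsbig1// => g _; rewrite fsfun0E mdeg0. Qed.

Lemma assignment_eq0 rho : (forall gamma j, rho gamma j = 0%N) -> rho = [fsfun with 0].
Proof.
by move=> r0; apply/fsfunP => g; rewrite fsfun0E; apply/ffunP => j; rewrite r0 ffunE.
Qed.

(** Every assignment is obtained from the empty one by finitely many increments
    of one entry of one value. *)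
Lemma assignment_ind (P : assignment -> Prop) : P [fsfun with 0] ->
  (forall gamma j rho, P rho -> P (bump gamma j rho)) -> forall rho, P rho.
Proof.
move=> P0 PS rho; have [m] := ubnP (mdeg (total rho)).
elim: m rho => // m IH rho; rewrite ltnS => rhom.
have [r0|/existsNP] :=
  pselect (forall p : nzmultiindex d * 'I_n, rho p.1 p.2 = 0%N).
  rewrite (@assignment_eq0 rho)// => g j; exact: (r0 (g, j)).
move=> [[g j] /eqP /unbump[rho' rhoE]]; rewrite rhoE; apply: PS; apply: IH.
by apply: leq_trans rhom; rewrite rhoE total_bump mdegD mdeg_mdelta addn1.
Qed.

Lemma total_eq0 rho : total rho = 0 -> rho = [fsfun with 0].
Proof.
elim/assignment_ind: rho => // g j rho _; rewrite total_bump => /ffunP/(_ j).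
by rewrite add_mdeltaE eqxx addn1 ffunE.
Qed.

Lemma mdeg_support rho gamma j :
  rho gamma j != 0%N -> (mdeg (val gamma) <= mdeg (weighted_total rho))%N.
Proof. by move=> /unbump[rho' ->]; rewrite weighted_total_bump mdegD leq_addl. Qed.

(** Each increment at gamma adds 1 on the left and |gamma| >= 1 on the right. *)
Lemma mdeg_total_le rho : (mdeg (total rho) <= mdeg (weighted_total rho))%N.
Proof.
elim/assignment_ind: rho => [|g j rho IH]; first by rewrite total0 mdeg0.
rewrite total_bump weighted_total_bump !mdegD mdeg_mdelta leq_add//.
by rewrite lt0n mdeg_eq0 (valP g).
Qed.

End Assignments.

(** * Partition sums *)

Section PartitionSums.
Context (R : numFieldType) (d n : nat).
Local Notation assignment := {fsfun nzmultiindex d -> multiindex n with 0}.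
Implicit Types (rho : assignment) (gamma : nzmultiindex d) (j : 'I_n).
Implicit Types (A : {ffun 'I_d -> int}) (B : {ffun 'I_n -> int}).

(** The targets range over integer, not natural, multi-indices: then A - gamma and
    B - e_j always make sense, and a partition sum with a negative target is an
    empty sum. *)
Definition assignments A B : set assignment :=
  [set rho | mint (weighted_total rho) = A /\ mint (total rho) = B].

Definition divided_power (a : multiindex d -> 'I_n -> R) gamma (mu : multiindex n) : R :=
  \prod_(j < n) (a (val gamma) j ^+ mu j / (mu j)`!%:R).

Definition partition_weight a rho : R :=
  \big[*%R/1]_(gamma \in [set: nzmultiindex d]) divided_power a gamma (rho gamma).

(** The coefficient of X^A in the product over j of P_j^(B_j) / (B_j)!, where P_j is
    the power series in X with coefficients a gamma j, gamma nonzero. *)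
Definition partition_sum a A B : R :=
  \sum_(rho \in assignments A B) partition_weight a rho.

Lemma divided_power0 a gamma : divided_power a gamma 0 = 1.
Proof. by rewrite /divided_power big1// => j _; rewrite ffunE expr0 fact0 divr1. Qed.

Lemma divided_power_mdelta a gamma (mu : multiindex n) j :
  ((mu + mdelta j)%R j)%:R * divided_power a gamma (mu + mdelta j) =
  a (val gamma) j * divided_power a gamma mu.
Proof.
rewrite /divided_power (bigD1 j)//= [in RHS](bigD1 j)//= !mulrA.
rewrite add_mdeltaE eqxx addn1 factS exprS natrM; congr (_ * _); last first.
  by apply: eq_bigr => i /negbTE ij; rewrite add_mdeltaE ij addn0.
have f0 : (mu j)`!%:R != 0 :> R by rewrite pnatr_eq0 -lt0n fact_gt0.
have m0 : (mu j).+1%:R != 0 :> R by rewrite pnatr_eq0.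
by field; rewrite f0 addrC natr1 m0.
Qed.

Lemma partition_weight_bump a gamma j rho :
  (bump gamma j rho gamma j)%:R * partition_weight a (bump gamma j rho) =
  a (val gamma) j * partition_weight a rho.
Proof.
rewrite /partition_weight.
have [t [-> ->]] :=
  @fsbig_bump d n R 1 *%R (divided_power a) gamma j rho (divided_power0 a).
by rewrite bumpE eqxx !mulrA divided_power_mdelta.
Qed.

Lemma assignments_bump A B gamma j rho :
  assignments A B (bump gamma j rho) <->
  assignments (A - mint (val gamma)) (B - mint (mdelta j)) rho.
Proof.
rewrite /assignments /= weighted_total_bump total_bump !mintD; split=> -[].
  by move=> <- <-; rewrite !addrK.
by move=> -> ->; rewrite !subrK.
Qed.

Lemma bump_bij A B gamma j :
  set_bij (assignments (A - mint (val gamma)) (B - mint (mdelta j)))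
    (assignments A B `&` [set rho : assignment | rho gamma j != 0%N]) (bump gamma j).
Proof.
split=> [rho Irho|rho rho' _ _|rho [Irho /= /unbump[rho' rhoE]]]; last first.
- by subst rho; exists rho'; [exact: ((assignments_bump A B gamma j rho').1 Irho)|].
- exact: bump_inj.
split; first exact/assignments_bump.
by rewrite /= bumpE eqxx add_mdeltaE eqxx addn1.
Qed.

Definition nzbox N : seq (nzmultiindex d) := pmap insub (box d N).

Lemma mem_nzbox N gamma : (gamma \in nzbox N) = (val gamma \in box d N).
Proof. exact: mem_pmap_sub. Qed.

Lemma big_nzbox (T : nmodType) N (F : multiindex d -> T) :
  \sum_(gamma <- nzbox N) F (val gamma) = \sum_(nu <- box d N | nu != 0) F nu.
Proof.
rewrite -(big_map val predT) /nzbox pmap_filter; last exact: insubK.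
by rewrite big_filter; apply: eq_bigl => nu; rewrite isSome_insub.
Qed.

Lemma total_box N rho j : (forall i, weighted_total rho i < N)%N ->
  total rho j = (\sum_(gamma <- nzbox N) rho gamma j)%N.
Proof.
elim/assignment_ind: rho => [|g k rho IH] rhoN.
  by rewrite total0 ffunE big1// => g _; rewrite fsfun0E ffunE.
have wE i : weighted_total (bump g k rho) i = (weighted_total rho i + val g i)%N.
  by rewrite weighted_total_bump ffunE.
have gN : g \in nzbox N.
  rewrite mem_nzbox mem_box; apply/forallP => i.
  by apply: leq_ltn_trans (rhoN i); rewrite wE leq_addl.
rewrite total_bump add_mdeltaE IH; last first.
  by move=> i; apply: leq_ltn_trans (rhoN i); rewrite wE leq_addr.
under [RHS]eq_bigr do rewrite bumpE ffunE.
rewrite big_split/=; congr (_ + _)%N.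
rewrite (bigD1_seq g)//= ?pmap_sub_uniq ?box_uniq// eqxx big1 ?addn0 ?ffunE//.
by move=> g' /negbTE ->; rewrite ffunE.
Qed.

(** By induction on |B|: an assignment whose total has a positive j-th entry is
    bump gamma j of a smaller one, for some gamma below A. *)
Lemma finite_assignments A B : finite_set (assignments A B).
Proof.
have [m] := ubnP `|isum B|%N; elim: m A B => // m IH A B Bm.
have [[beta BE]|[j Bj]] := mint_or_negative B; last first.
  apply: (sub_finite_set _ (@finite_set0 assignment)) => rho [_ rhoB].
  by move: Bj; rewrite -rhoB ffunE.
have [[alpha AE]|[i Ai]] := mint_or_negative A; last first.
  apply: (sub_finite_set _ (@finite_set0 assignment)) => rho [rhoA _].
  by move: Ai; rewrite -rhoA ffunE.
have [b0|] := eqVneq beta 0.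
  apply: (sub_finite_set _ (@finite_set1 _ ([fsfun with 0] : assignment))) => rho [_].
  by rewrite BE b0 => /mint_inj/total_eq0.
move=> /multiindex_neq0P[j bj].
pose N := (\max_i alpha i).+1.
have alphaN i : (alpha i < N)%N by rewrite ltnS leq_bigmax.
apply: (@sub_finite_set _ _ (\bigcup_(g in [set` nzbox N])
   (bump g j @` assignments (A - mint (val g)) (B - mint (mdelta j))))).
  move=> rho rhoI; have [rhoA rhoB] := rhoI.
  have wtot i : weighted_total rho i = alpha i.
    by move: rhoA; rewrite AE => /mint_inj ->.
  have := @total_box N rho j (fun i => _).
  rewrite (_ : total rho = beta); last by move: rhoB; rewrite BE => /mint_inj.
  move=> totE.
  have : (\sum_(g <- nzbox N) rho g j)%N != 0%N.
    by rewrite -totE// => i; rewrite wtot.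
  rewrite sum_nat_seq_neq0 => /hasP[g gN /= rg].
  have [rho' rhoE] := unbump rg; subst rho.
  exists g; first exact: gN.
  by exists rho'; [exact: ((assignments_bump A B g j rho').1 rhoI)|].
apply: bigcup_finite => [|g _]; first exact: finite_seq.
apply: finite_image; apply: IH.
rewrite BE isumB !isum_mint mdeg_mdelta.
move: Bm; rewrite BE isum_mint.
have := leq_mdeg beta j; move: bj; rewrite -lt0n.
lia.
Qed.

Lemma partition_sum_negl a A B i : A i < 0 -> partition_sum a A B = 0.
Proof.
move=> Ai; apply: fsbig1 => rho [rhoA _].
by move: Ai; rewrite -rhoA ffunE.
Qed.

Lemma partition_sum_negr a A B j : B j < 0 -> partition_sum a A B = 0.
Proof.
move=> Bj; apply: fsbig1 => rho [_ rhoB].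
by move: Bj; rewrite -rhoB ffunE.
Qed.

Lemma partition_sum_deg a A B : isum A < isum B -> partition_sum a A B = 0.
Proof.
move=> AB; apply: fsbig1 => rho [rhoA rhoB]; move: AB.
by rewrite -rhoA -rhoB !isum_mint ltz_nat ltnNge mdeg_total_le.
Qed.

Lemma partition_sum0 a A : partition_sum a A 0 = (A == 0)%:R.
Proof.
have sub0 rho : mint (total rho) = 0 -> rho = [fsfun with 0].
  by rewrite -(mint0 n) => /mint_inj/total_eq0.
have [->|A0] := eqVneq A 0; last first.
  apply: fsbig1 => rho [rhoA /sub0 rho0]; case/eqP: A0.
  by rewrite -rhoA rho0 weighted_total0 mint0.
rewrite /partition_sum (_ : assignments 0 0 = [set [fsfun with 0]]).
  by rewrite fsbig_set1 /partition_weight fsbig1// => g _; rewrite fsfun0E divided_power0.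
apply/seteqP; split=> [rho [_ /sub0]//|rho ->].
by split; rewrite ?weighted_total0 ?total0 mint0.
Qed.

(** Double counting: B_j is the sum over gamma of rho(gamma)_j, and weighting the
    sum over rho by rho(gamma)_j amounts, through the bijection bump gamma j, to
    taking one factor a gamma j out of each term. In terms of generating series:
    B_j P^B / B! = P_j P^(B - e_j) / (B - e_j)!. *)
Lemma partition_sum_rec a A B j N : (forall i, A i < N%:Z) ->
  (B j)%:~R * partition_sum a A B =
  \sum_(nu <- box d N | nu != 0)
    a nu j * partition_sum a (A - mint nu) (B - mint (mdelta j)).
Proof.
move=> AN; rewrite -(@big_nzbox R N (fun nu => a nu j *
  partition_sum a (A - mint nu) (B - mint (mdelta j)))) mulr_fsumr.
have multE rho : assignments A B rho ->
    (B j)%:~R = \sum_(g <- nzbox N) (rho g j)%:R :> R.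
  move=> [rhoA rhoB]; rewrite -rhoB ffunE (@total_box N) -?pmulrn ?natr_sum//.
  by move=> i; have := AN i; rewrite -rhoA ffunE ltz_nat.
rewrite (eq_fsbigr (fun rho => \sum_(g <- nzbox N) (rho g j)%:R *
    partition_weight a rho)); last first.
  by move=> rho; rewrite inE => /multE ->; rewrite mulr_suml.
rewrite (fsbig_finite _ _ (finite_assignments A B)) exchange_big/=.
apply: eq_bigr => g _.
rewrite -(fsbig_finite _ _ (finite_assignments A B)) mulr_fsumr.
rewrite -(@fsbig_widen _ _ _ _
  (assignments A B `&` [set rho : assignment | rho g j != 0%N])).
- rewrite (reindex_fsbig _ _ _ _ (bump_bij A B g j)).
  by apply: eq_fsbigr => rho _; exact: partition_weight_bump.
- exact: subIsetl.
by move=> rho [Irho /not_andP[//|/negP/negPn/eqP r0]]; rewrite /= r0 mul0r.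
Qed.

End PartitionSums.

(** * Derivatives of partition sums *)

Section PartitionSumShift.
Context (R : numFieldType) (d n : nat) (a : multiindex d -> 'I_n -> R).
Implicit Types (A : {ffun 'I_d -> int}) (B : {ffun 'I_n -> int}).

(** Both sums run over the terms nu_i a_nu of the derivative of P_j with respect
    to X_i, on the left after the shift of nu by e_i; the shift creates the index
    nu = 0, whose term is subtracted. *)
Lemma sum_shifted_coefficients A B i j N : (forall k, A k + 1 < N%:Z) ->
  \sum_(nu <- box d N | nu != 0)
    (nu i).+1%:R * a (nu + mdelta i) j * partition_sum a (A - mint nu) B =
  \sum_(nu <- box d N | nu != 0)
    (nu i)%:R * a nu j * partition_sum a (A + mint (mdelta i) - mint nu) B
  - a (mdelta i) j * partition_sum a A B.
Proof.
move=> AN; have [N0|N0] := posnP N.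
  have b0 : box d N = [::].
    case E : (box d N) => [//|nu s].
    have : nu \in box d N by rewrite E inE eqxx.
    by rewrite mem_box => /forallP/(_ i); rewrite N0.
  have Ai : A i < 0 by have := AN i; rewrite N0; lia.
  by rewrite b0 !big_nil (partition_sum_negl _ _ Ai) mulr0 subr0.
pose F (nu : multiindex d) :=
  (nu i)%:R * a nu j * partition_sum a (A + mint (mdelta i) - mint nu) B.
have Fout nu : nu \notin box d N -> F nu = 0.
  rewrite mem_box => /forallPn[k]; rewrite -leqNgt => Nk.
  rewrite /F (@partition_sum_negl _ _ _ _ _ _ k) ?mulr0// !ffunE.
  by have := AN k; move: (nu k) Nk => m Nm; case: (k == i) => /=; lia.
have Fi (nu : multiindex d) : nu i = 0%N -> F nu = 0 by move=> nui; rewrite /F nui !mul0r.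
have := big_box_shift Fout Fi; rewrite !big_box_neq0// (Fi 0) ?ffunE// add0r => ->.
rewrite /F add0r ffunE eqxx mul1r addrK [_ + \sum_(_ <- _ | _) _]addrC addrK.
apply: eq_bigr => nu _; rewrite add_mdeltaE eqxx addn1 mintD.
by rewrite opprD [- mint nu - _]addrC addrA addrK.
Qed.

(** With nu_i + (A_i + 1 - nu_i) = A_i + 1, the recursion at A + e_i reassembles
    the terms with derivatives; the recursion at B - e_l reassembles those of the
    inner sums, where the coefficient is (B - e_l)_j instead of B_j. For l = j the
    difference cancels the boundary term of the shift. *)
Lemma partition_sum_rec_shift A B i j N : (forall k, A k + 1 < N%:Z) ->
  \sum_(nu <- box d N | nu != 0)
    ((nu i).+1%:R * a (nu + mdelta i) j *
       partition_sum a (A - mint nu) (B - mint (mdelta j)) +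
     a nu j * (((A - mint nu) i + 1)%:~R *
         partition_sum a (A - mint nu + mint (mdelta i)) (B - mint (mdelta j))
       - \sum_(l < n) a (mdelta i) l *
         partition_sum a (A - mint nu) (B - mint (mdelta j) - mint (mdelta l)))) =
  (B j)%:~R * ((A i + 1)%:~R * partition_sum a (A + mint (mdelta i)) B
     - \sum_(l < n) a (mdelta i) l * partition_sum a A (B - mint (mdelta l))).
Proof.
move=> AN; rewrite big_split/= sum_shifted_coefficients//.
have AN' k : A k < N%:Z by have := AN k; lia.
have AiN k : (A + mint (mdelta i)) k < N%:Z.
  by have := AN k; rewrite !ffunE; case: (k == i) => /=; lia.
have bjl l : (B j)%:~R * partition_sum a A (B - mint (mdelta l)) =
    \sum_(nu <- box d N | nu != 0) a nu j *
      partition_sum a (A - mint nu) (B - mint (mdelta j) - mint (mdelta l)) +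
    (j == l)%:R * partition_sum a A (B - mint (mdelta l)).
  have := @partition_sum_rec R d n a A (B - mint (mdelta l)) j N AN'.
  under [X in _ = X -> _]eq_bigr do rewrite addrAC.
  move=> <-; rewrite -mulrDl; congr (_ * _).
  by rewrite !ffunE intrB -!pmulrn subrK.
have AE nu : A - mint nu + mint (mdelta i) = A + mint (mdelta i) - mint nu.
  by rewrite addrAC.
pose Q nu := partition_sum a (A + mint (mdelta i) - mint nu) (B - mint (mdelta j)).
pose P l nu :=
  partition_sum a (A - mint nu) (B - mint (mdelta j) - mint (mdelta l)).
have -> : \sum_(nu <- box d N | nu != 0)
     a nu j * (((A - mint nu) i + 1)%:~R *
         partition_sum a (A - mint nu + mint (mdelta i)) (B - mint (mdelta j))
       - \sum_(l < n) a (mdelta i) l *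
         partition_sum a (A - mint nu) (B - mint (mdelta j) - mint (mdelta l))) =
  \sum_(nu <- box d N | nu != 0) a nu j * (((A - mint nu) i + 1)%:~R * Q nu) -
  \sum_(l < n) a (mdelta i) l * (\sum_(nu <- box d N | nu != 0) a nu j * P l nu).
  under eq_bigr do rewrite AE mulrBr.
  rewrite sumrB; congr (_ - _); under [RHS]eq_bigr do rewrite mulr_sumr.
  rewrite exchange_big/=; apply: eq_bigr => nu _; rewrite mulr_sumr.
  by apply: eq_bigr => l _; rewrite mulrCA.
rewrite mulrBr mulrCA (partition_sum_rec _ _ _ AiN).
rewrite [X in _ = X - _]mulr_sumr [X in _ = _ - X]mulr_sumr.
under [X in _ = _ - X]eq_bigr do rewrite mulrCA bjl mulrDr.
rewrite big_split/= [X in _ = _ - (_ + X)](bigD1 j)//= eqxx mul1r.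
rewrite [X in _ = _ - (_ + (_ + X))]big1 ?addr0; last first.
  by move=> l /negbTE lj; rewrite eq_sym lj mul0r mulr0.
have regroup (s1 s2 c t : R) : s1 - c + (s2 - t) = s1 + s2 - (t + c) by ring.
rewrite regroup; congr (_ - _); rewrite -big_split/=; apply: eq_bigr => nu _.
by rewrite -/(Q nu) !ffunE !intrD mulrNz -!pmulrn; ring.
Qed.

End PartitionSumShift.

Section PartitionSumDerivative.
Context (R : realType) (V : normedModType R) (d n : nat).
Implicit Types (A : {ffun 'I_d -> int}) (B : {ffun 'I_n -> int}).

Lemma is_derive_big_seq (I : Type) (s : seq I) (P : pred I) (F : I -> V -> R)
    (dF : I -> R) (x v : V) :
  (forall i, P i -> is_derive x v (F i) (dF i)) ->
  is_derive x v (fun y => \sum_(i <- s | P i) F i y) (\sum_(i <- s | P i) dF i).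
Proof.
move=> dFP; elim: s => [|i s IH].
  rewrite big_nil; under eq_fun do rewrite big_nil.
  exact: is_derive_cst.
rewrite big_cons; under eq_fun do rewrite big_cons.
by case: ifP => // Pi; apply: is_deriveD => //; exact: dFP.
Qed.

(** If the coefficients behave like Taylor coefficients, that is, if deriving
    a_nu in the direction v gives (nu_i + 1) a_(nu + e_i), then so do the partition
    sums, up to a correction: deriving the generating series P_j in v is
    deriving it in X_i and removing the constant term a_(e_i) that appears.
    The proof is an induction on |B| through [partition_sum_rec]. *)
Lemma is_derive_partition_sum (a : V -> multiindex d -> 'I_n -> R) (x v : V)
    (i : 'I_d) (k : nat) :
  (forall nu j, nu != 0 -> (mdeg nu <= k)%N ->
     is_derive x v (fun y => a y nu j) ((nu i).+1%:R * a x (nu + mdelta i) j)) ->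
  forall B A, isum A <= k%:Z ->
  is_derive x v (fun y => partition_sum (a y) A B)
    ((A i + 1)%:~R * partition_sum (a x) (A + mint (mdelta i)) B
     - \sum_(l < n) a x (mdelta i) l * partition_sum (a x) A (B - mint (mdelta l))).
Proof.
move=> da B; have [m] := ubnP `|isum B|%N; elim: m B => // m IH B Bm A Ak.
have dcst (c : R) (F : V -> R) D : (forall y, F y = c) -> 0 = D -> is_derive x v F D.
  move=> Fc <-; have -> : F = cst c by apply/funext.
  exact: is_derive_cst.
have [[beta BE]|[j Bj]] := mint_or_negative B; last first.
  apply: (dcst 0) => [y|]; first by rewrite (partition_sum_negr _ _ Bj).
  rewrite (partition_sum_negr _ _ Bj) mulr0 big1 ?subr0// => l _.
  rewrite (@partition_sum_negr _ _ _ _ _ _ j) ?mulr0//.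
  by rewrite !ffunE; move: Bj; case: (j == l) => /=; lia.
have [b0|] := eqVneq beta 0.
  rewrite {}BE {}b0 mint0 {Bm}.
  apply: (dcst (A == 0)%:R) => [y|]; first exact: partition_sum0.
  rewrite partition_sum0 big1 ?subr0 => [|l _]; last first.
    rewrite (@partition_sum_negr _ _ _ _ _ _ l) ?mulr0//.
    by rewrite !ffunE eqxx.
  case: eqVneq => [/ffunP/(_ i)|_]; last by rewrite mulr0.
  by rewrite !ffunE eqxx => ->; rewrite mul0r.
move=> /multiindex_neq0P[j bj].
have Bj0 : (B j)%:~R != 0 :> R.
  by rewrite BE ffunE -pmulrn pnatr_eq0.
pose N := (\max_k `|A k|%N).+2.
have AN l : A l + 1 < N%:Z.
  have : (`|A l| <= \max_k `|A k|)%N by exact: leq_bigmax.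
  rewrite /N; lia.
have AN' l : A l < N%:Z by have := AN l; lia.
have -> : (fun y => partition_sum (a y) A B) = (fun y => (B j)%:~R^-1 *
    \sum_(nu <- box d N | nu != 0)
      a y nu j * partition_sum (a y) (A - mint nu) (B - mint (mdelta j))).
  by apply/funext => y; rewrite -partition_sum_rec// mulKf.
rewrite -[X in is_derive _ _ _ X](mulKf Bj0).
rewrite -(@partition_sum_rec_shift R d n (a x) A B i j N AN).
apply: is_deriveZ; apply: is_derive_big_seq => nu nu0.
have IHnu : is_derive x v
    (fun y => partition_sum (a y) (A - mint nu) (B - mint (mdelta j)))
    (((A - mint nu) i + 1)%:~R *
      partition_sum (a x) (A - mint nu + mint (mdelta i)) (B - mint (mdelta j))
    - \sum_(l < n) a x (mdelta i) l *
      partition_sum (a x) (A - mint nu) (B - mint (mdelta j) - mint (mdelta l))).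
  apply: IH; last by rewrite isumB isum_mint; lia.
  rewrite BE isumB !isum_mint mdeg_mdelta.
  move: Bm; rewrite BE isum_mint.
  have := leq_mdeg beta j; move: bj; rewrite -lt0n.
  lia.
(* If nu is not below A, then a_nu may not be differentiable, but it is multiplied
   by the zero function. The value predicted for the derivative of the latter is
   zero because derivatives are unique. *)
have [[mu muE]|[l Al]] := mint_or_negative (A - mint nu); last first.
  have P0 y B' : partition_sum (a y) (A - mint nu) B' = 0 :=
    partition_sum_negl _ _ Al.
  rewrite [X in is_derive _ _ X _](_ : _ = cst 0); last first.
    by apply/funext => y; rewrite P0 mulr0.
  rewrite P0 mulr0 add0r.
  have IHnu0 : is_derive x v
    (fun y => partition_sum (a y) (A - mint nu) (B - mint (mdelta j))) 0.
    exact: (dcst 0).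
  rewrite -(derive_val (is_derive := IHnu)) (derive_val (is_derive := IHnu0)) mulr0.
  exact: is_derive_cst.
have nuk : (mdeg nu <= k)%N.
  move: Ak; have -> : A = mint mu + mint nu by rewrite -muE subrK.
  by rewrite -mintD isum_mint mdegD; lia.
have danu := da nu j nu0 nuk.
have dM := is_deriveM danu IHnu; apply: (is_derive_eq dM).
rewrite /= addrC /GRing.scale /=; congr (_ + _).
by rewrite mulrC.
Qed.

End PartitionSumDerivative.

(** * The formula of Faa di Bruno *)

Section FaaDiBruno.
Context (R : realType) (d n k : nat) (U : set 'rV[R]_d) (oU : open U).
Context (phi : 'rV[R]_d -> 'rV[R]_n) (Cphi : Ck k U phi).
Context (f : 'rV[R]_n -> R) (Cf : Ck k [set: 'rV[R]_n] f).

Definition taylor_coef (x : 'rV[R]_d) (nu : multiindex d) (j : 'I_n) : R :=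
  (mfact nu)%:R^-1 * mpartial nu (fun y => phi y 0 j) x.

Let phi_coord j : Ck k U (fun y => phi y 0 j).
Proof. exact: Ck_coord. Qed.

Lemma is_derive_mpartial D (W : set 'rV[R]_D) (oW : open W) (g : 'rV[R]_D -> R)
    (nu : multiindex D) i x : Ck k W g -> (mdeg nu < k)%N -> W x ->
  is_derive x (delta_mx 0 i) (mpartial nu g) (mpartial (nu + mdelta i) g x).
Proof.
move=> Cg nuk Wx; rewrite -(partial_mpartial oW)//; last exact: Ck_le Cg.
apply/derivableP/diff_derivable.
have C1 : Ck 1 W (mpartial nu g).
  by apply: (Ck_mpartial oW); apply: Ck_le Cg; rewrite addn1.
exact: Ck_differentiable C1 Wx.
Qed.

Lemma is_derive_taylor_coef x (i : 'I_d) (nu : multiindex d) j :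
  (mdeg nu < k)%N -> U x ->
  is_derive x (delta_mx 0 i) (fun y => taylor_coef y nu j)
    ((nu i).+1%:R * taylor_coef x (nu + mdelta i) j).
Proof.
move=> nuk Ux; rewrite /taylor_coef mfact_mdelta natrM invfM mulrA mulrA.
rewrite divff ?mul1r; last by rewrite pnatr_eq0.
exact: is_deriveZ (is_derive_mpartial _ _ (phi_coord j) nuk Ux).
Qed.

Lemma taylor_coef_mdelta x i j : (0 < k)%N -> U x ->
  taylor_coef x (mdelta i) j = partial i (fun y => phi y 0 j) x.
Proof.
move=> k0 Ux; rewrite /taylor_coef -[mdelta i]add0r mfact_mdelta mfact0 ffunE.
rewrite invr1 mul1r -(partial_mpartial oU) ?mpartial0//.
by rewrite mdeg0; exact: Ck_le (phi_coord j).
Qed.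

Local Notation P x A B := (partition_sum (taylor_coef x) A B).

Lemma is_derive_comp_mpartial x (i : 'I_d) (beta : multiindex n) :
  (mdeg beta < k)%N -> U x ->
  is_derive x (delta_mx 0 i) (fun y => mpartial beta f (phi y))
    (\sum_(j < n)
       taylor_coef x (mdelta i) j * mpartial (beta + mdelta j) f (phi x)).
Proof.
move=> bk Ux; have k0 : (0 < k)%N by apply: leq_ltn_trans bk.
have C1 : Ck 1 [set: 'rV[R]_n] (mpartial beta f).
  by apply: (Ck_mpartial openT); apply: Ck_le Cf; rewrite addn1.
have dphi : differentiable phi x := Ck_differentiable k0 Cphi Ux.
have df : differentiable (mpartial beta f) (phi x).
  exact: Ck_differentiable C1 I.
apply: is_derive_eq; first exact: partial_comp i dphi df.
apply: eq_bigr => j _; rewrite taylor_coef_mdelta// mulrC (partial_mpartial openT)//.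
exact: Ck_le Cf.
Qed.

(** The chain rule raises beta by e_j. After the shift beta + e_j |-> beta these terms
    cancel the correction in the derivatives of the partition sums. *)
Lemma sum_box_cancel x (alpha : multiindex d) (i : 'I_d) : (mdeg alpha < k)%N ->
  \sum_(beta <- box n k.+1)
    ((\sum_(j < n)
        taylor_coef x (mdelta i) j * mpartial (beta + mdelta j) f (phi x)) *
       P x (mint alpha) (mint beta) +
     mpartial beta f (phi x) *
       ((alpha i).+1%:R * P x (mint (alpha + mdelta i)) (mint beta) -
        \sum_(l < n) taylor_coef x (mdelta i) l *
           P x (mint alpha) (mint beta - mint (mdelta l)))) =
  (alpha i).+1%:R * \sum_(beta <- box n k.+1)
    mpartial beta f (phi x) * P x (mint (alpha + mdelta i)) (mint beta).
Proof.
move=> ak; rewrite big_split/=.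
under [X in _ + X = _]eq_bigr do rewrite mulrBr.
rewrite sumrB.
have -> : \sum_(beta <- box n k.+1) (\sum_(j < n)
      taylor_coef x (mdelta i) j * mpartial (beta + mdelta j) f (phi x)) *
      P x (mint alpha) (mint beta) =
    \sum_(beta <- box n k.+1) mpartial beta f (phi x) *
      (\sum_(l < n) taylor_coef x (mdelta i) l *
           P x (mint alpha) (mint beta - mint (mdelta l))).
  under eq_bigr do rewrite mulr_suml.
  under [RHS]eq_bigr do rewrite mulr_sumr.
  rewrite exchange_big [RHS]exchange_big/=; apply: eq_bigr => j _.
  pose F (beta : multiindex n) := mpartial beta f (phi x) *
    (taylor_coef x (mdelta i) j * P x (mint alpha) (mint beta - mint (mdelta j))).
  rewrite [RHS](@big_box_shift n R k.+1 F j) /F.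
  - by apply: eq_bigr => beta _; rewrite mintD addrK mulrCA mulrA.
  - move=> beta; rewrite mem_box => /forallPn[l]; rewrite -leqNgt => bl.
    rewrite partition_sum_deg ?mulr0// isumB !isum_mint mdeg_mdelta.
    by have := leq_mdeg beta l; lia.
  - move=> beta bj; rewrite (@partition_sum_negr _ _ _ _ _ _ j) ?mulr0//.
    by rewrite !ffunE eqxx bj.
rewrite addrCA subrr addr0 mulr_sumr; apply: eq_bigr => beta _.
by rewrite mulrCA.
Qed.

(** By induction on |alpha|, at all points of U simultaneously: one derivative of
    the identity for alpha' gives the identity for alpha' + e_i, both sides being
    multiplied by alpha'_i + 1 after the division by the factorials. *)
Lemma faa_di_bruno_box alpha x : (mdeg alpha <= k)%N -> U x ->
  mpartial alpha (f \o phi) x / (mfact alpha)%:R =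
  \sum_(beta <- box n k.+1)
    mpartial beta f (phi x) * P x (mint alpha) (mint beta).
Proof.
have [m] := ubnP (mdeg alpha); elim: m alpha x => // m IH alpha x am ak Ux.
have [->|alpha0] := eqVneq alpha 0.
  rewrite mpartial0 mfact0 divr1 mint0.
  rewrite big_box_neq0// mint0 partition_sum0 eqxx mulr1 mpartial0.
  rewrite big1_seq ?addr0// => beta /andP[b0 _].
  rewrite partition_sum_deg ?mulr0// -(mint0 d) !isum_mint mdeg0 ltz_nat lt0n.
  by rewrite mdeg_eq0.
have [i [alpha' [alphaE ->]]] := mpartial_outermost R alpha0.
have degE : mdeg alpha = (mdeg alpha').+1 by rewrite alphaE mdegD mdeg_mdelta addn1.
have ak' : (mdeg alpha' < k)%N by rewrite -degE.
pose F y := \sum_(beta <- box n k.+1)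
    mpartial beta f (phi y) * P y (mint alpha') (mint beta).
have alphaF y : U y -> (mfact alpha')%:R * F y = mpartial alpha' (f \o phi) y.
  move=> Uy; rewrite /F -IH//; [|by rewrite -ltnS -degE|exact: ltnW].
  by rewrite mulrC divfK// mfact_neq0.
have dP beta : is_derive x (delta_mx 0 i) (fun y => P y (mint alpha') (mint beta))
    ((alpha' i).+1%:R * P x (mint (alpha' + mdelta i)) (mint beta) -
        \sum_(l < n) taylor_coef x (mdelta i) l *
           P x (mint alpha') (mint beta - mint (mdelta l))).
  apply: is_derive_eq.
    apply: (@is_derive_partition_sum _ _ _ _ taylor_coef x _ i (mdeg alpha')).
      move=> nu j _ nua; apply: is_derive_taylor_coef => //.
      exact: leq_ltn_trans ak'.
    by rewrite isum_mint.
  by rewrite mintD ffunE -natr1 intrD -pmulrn.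
have dF : is_derive x (delta_mx 0 i) F ((alpha' i).+1%:R *
    \sum_(beta <- box n k.+1)
      mpartial beta f (phi x) * P x (mint (alpha' + mdelta i)) (mint beta)).
  rewrite -sum_box_cancel//.
  apply: is_derive_big_seq => beta _; have dPb := dP beta.
  have [bk|kb] := ltnP (mdeg beta) k.
    have dM := is_deriveM (is_derive_comp_mpartial i bk Ux) dPb.
    apply: (is_derive_eq dM).
    rewrite addrC /GRing.scale/= mulrC [X in _ + X = _]mulrC.
    by congr (_ + _); rewrite mulrC.
  (* For |beta| = k or more, the derivatives of order beta of f may not be
     differentiable, but their coefficient is the zero function. *)
  have P0 y : P y (mint alpha') (mint beta) = 0.
    by rewrite partition_sum_deg// !isum_mint ltz_nat; exact: leq_trans kb.
  have dP0 : is_derive x (delta_mx 0 i) (fun y => P y (mint alpha') (mint beta)) 0.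
    rewrite [X in is_derive _ _ X _](_ : _ = cst 0); first exact: is_derive_cst.
    exact/funext.
  rewrite -(derive_val (is_derive := dPb)) (derive_val (is_derive := dP0)).
  rewrite P0 !mulr0 addr0 [X in is_derive _ _ X _](_ : _ = cst 0).
    exact: is_derive_cst.
  by apply/funext => y; rewrite P0 mulr0.
have -> : partial i (mpartial alpha' (f \o phi)) x =
    partial i (fun y => (mfact alpha')%:R * F y) x.
  by apply/esym; apply: (eq_partial oU).
have dFZ := is_deriveZ (mfact alpha')%:R dF.
rewrite /partial (derive_val (is_derive := dFZ)) alphaE mfact_mdelta natrM.
have c0 := mfact_neq0 R alpha'.
have p0 : (alpha' i).+1%:R != 0 :> R by rewrite pnatr_eq0.
rewrite /GRing.scale/= mulrA [(mfact alpha')%:R * _]mulrC mulrAC divff ?mul1r//.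
exact: mulf_neq0.
Qed.

End FaaDiBruno.

Lemma faa_di_bruno_indexE d n (alpha : multiindex d) (beta : multiindex n) :
  faa_di_bruno_index alpha beta = assignments (mint alpha) (mint beta).
Proof.
apply/seteqP; split=> rho; rewrite /faa_di_bruno_index /assignments /=.
  by move=> [E1 E2]; split; congr mint.
by move=> [/mint_inj E1 /mint_inj E2]; split.
Qed.

Unset Implicit Arguments.

Theorem theorem19 (R : realType) (d n k : nat)
    (hd : (1 <= d)%N) (hn : (1 <= n)%N) (hk : (1 <= k)%N)
    (U : set 'rV[R]_d) (hU : open U) (x : 'rV[R]_d) (hx : U x)
    (phi : 'rV[R]_d -> 'rV[R]_n) (hphi : Ck k U phi)
    (f : 'rV[R]_n -> R) (hf : Ck k [set: 'rV[R]_n] f)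
    (alpha : multiindex d) (halpha0 : alpha <> 0)
    (halphak : (mdeg alpha <= k)%N) :
  mpartial alpha (f \o phi) x / (mfact alpha)%:R =
  \sum_(beta \in [set: multiindex n])
    mpartial beta f (phi x) *
    \sum_(rho \in faa_di_bruno_index alpha beta)
      \big[*%R/1]_(gamma \in [set: nzmultiindex d])
        ((mfact (rho gamma))%:R^-1 *
         (mpow (mpartial (val gamma) phi x) (rho gamma) /
          (mfact (val gamma))%:R ^+ mdeg (rho gamma))).
Proof.
rewrite (faa_di_bruno_box hU hphi hf halphak hx).
pose T beta := mpartial beta f (phi x) *
  partition_sum (taylor_coef phi x) (mint alpha) (mint beta).
transitivity (\sum_(beta \in [set: multiindex n]) T beta).
  rewrite (fsbigE (box n k.+1)) ?box_uniq//.
    by apply: eq_bigl => beta; rewrite in_setT.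
  move=> beta _; rewrite mem_box => /forallPn[l]; rewrite -leqNgt => bl.
  rewrite /T partition_sum_deg ?mulr0// !isum_mint ltz_nat.
  apply: (leq_ltn_trans halphak); apply: (leq_trans bl).
  exact: leq_mdeg.
apply: eq_fsbigr => beta _; rewrite /T faa_di_bruno_indexE; congr (_ * _).
apply: eq_fsbigr => rho; rewrite inE => -[/mint_inj rhoA _].
apply: eq_fsbigr => gamma _.
(* Where the exponent is positive, gamma has order at most k, so that the
   derivative of order gamma may be taken componentwise. *)
have coord j : rho gamma j != 0%N ->
    mpartial (val gamma) phi x 0 j = mpartial (val gamma) (fun y => phi y 0 j) x.
  move=> rj; apply: (mpartial_coord hU) => //; apply: Ck_le hphi.
  by apply: leq_trans halphak; rewrite -rhoA; exact: mdeg_support rj.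
rewrite /divided_power /mpow /mdeg -prodrXr.
rewrite {1}/mfact natr_prod -prodf_div -prodfV -big_split/=.
apply: eq_bigr => j _; rewrite /taylor_coef.
have [r0|/coord <-] := eqVneq (rho gamma j) 0%N.
  by rewrite r0 !expr0 fact0 invr1 !mulr1.
by rewrite [LHS]mulrC exprMn exprVn; congr (_ * _); rewrite mulrC.
Qed.
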